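(* Let $S\in GS_2(I,X,\beta)$ have the two expansions $$S=\sum_{k=0}^{2n+1}\gamma_kB_k=\sum_{l=0}^{4n+1}\delta_l\bar B_l$$ with respect to the generalized quadratic B-spline bases of $GS_2(I,X,\beta)$ (coarse) and of the refined space $GS_2(I,\bar X,\bar\beta)$ (fine). Then, for $1\le i\le n$, $$\delta_{4i-2}=\big(\tfrac12-\tfrac14\beta_i\big)\gamma_{2i-1}+\big(\tfrac12+\tfrac14\beta_i\big)\gamma_{2i},\qquad \delta_{4i-1}=\big(\tfrac12+\tfrac14\beta_i\big)\gamma_{2i-1}+\big(\tfrac12-\tfrac14\beta_i\big)\gamma_{2i},$$ and, for $0\le i\le n$, $$\delta_{4i}=\tfrac12(1+\omega_i)\gamma_{2i}+\tfrac12(1-\omega_i)\gamma_{2i+1},\qquad \delta_{4i+1}=\tfrac12\omega_i\gamma_{2i}+\tfrac12(2-\omega_i)\gamma_{2i+1}.$$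
   Context: Setting. Let $n\ge 1$, $I=[a,b]$, $X=\{a=x_0<x_1<\dots<x_n=b\}$ a partition of $I$, $I_i=[x_{i-1},x_i]$, $h_i=x_i-x_{i-1}$, $m_i=\frac12(x_{i-1}+x_i)$ for $1\le i\le n$. Let $\beta=(\beta_1,\dots,\beta_n)$ with $\beta_i\in[-1,0[$ and $\theta_i=\frac12\frac{\beta_i}{\beta_i-1}\in\,]0,\frac14]$ (equivalently $\beta_i=\frac{-2\theta_i}{1-2\theta_i}$). The space $V(\beta_i)$ (generated by the Merrien subdivision algorithm) is the set of $C^1$ functions $f$ on $I_i$ such that for every dyadic subinterval $[u,v]$ of $I_i$ (i.e. every interval obtained from $I_i$ by repeated bisection, including $I_i$ itself), with $m=\frac12(u+v)$ and $h=v-u$, $$f(m)=\tfrac12\big(f(u)+f(v)-\theta_i h\,(f'(v)-f'(u))\big),\qquad f'(m)=\frac{1}{1-2\theta_i}\Big(\frac{f(v)-f(u)}{h}-2\theta_i\,\frac{f'(u)+f'(v)}{2}\Big).$$ It is known that for any prescribed values of $f,f'$ at the two endpoints of $I_i$ there is exactly one such $f$; so $\dim V(\beta_i)=4$. $GS_2(\beta)=GS_2(I,X,\beta)$ is the space of all $g\in C^1(I)$ with $g|_{I_i}\in V(\beta_i)$ for all $1\le i\le n$ (generalized quadratic splines); it has dimension $2n+2$. The list of B-coefficients of $f\in V(\beta_i)$ on $I_i$ is $[\,f(x_{i-1}),\ f(x_{i-1})+\theta_ih_if'(x_{i-1}),\ f(x_i)-\theta_ih_if'(x_i),\ f(x_i)\,]$;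 it determines $f$ uniquely. For $1\le i\le n-1$ let $\omega_i=\frac{\theta_{i+1}h_{i+1}}{\theta_ih_i+\theta_{i+1}h_{i+1}}$, and let $\omega_0=1$, $\omega_n=0$. The generalized quadratic B-splines are the functions on $I$ defined by their B-coefficients as follows (all B-coefficients on subintervals not mentioned are zero). For $1\le i\le n-1$: $B_{2i}$ has lists $[0,0,1,\omega_i]$ on $I_i$ and $[\omega_i,0,0,0]$ on $I_{i+1}$; $B_{2i+1}$ has lists $[0,0,0,1-\omega_i]$ on $I_i$ and $[1-\omega_i,1,0,0]$ on $I_{i+1}$. At the ends: $B_0$ has list $[1,0,0,0]$ on $I_1$; $B_1$ has list $[0,1,0,0]$ on $I_1$; $B_{2n}$ has list $[0,0,1,0]$ on $I_n$; $B_{2n+1}$ has list $[0,0,0,1]$ on $I_n$. The family $\{B_k\}_{0\le k\le 2n+1}$ is a basis of $GS_2(\beta)$. Refinement. Let $\bar X=X\cup\{m_i,\ 1\le i\le n\}$, which divides $I$ into $2n$ subintervals, and $\bar\beta=(\beta_1,\beta_1,\beta_2,\beta_2,\dots,\beta_n,\beta_n)$. Then $GS_2(I,X,\beta)$ is a subspace of $GS_2(I,\bar X,\bar\beta)$, which has dimension $4n+2$. The functions $\bar B_l$, $0\le l\le 4n+1$, are the generalized quadratic B-splines of $GS_2(I,\bar X,\bar\beta)$, i.e. the following functions. Write $J_{2i-1}=[x_{i-1},m_i]$ and $J_{2i}=[m_i,x_i]$ for $1\le i\le n$; on both of these subintervals the parameter is $\theta_i$ and the length is $\frac12h_i$, so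 that the list of B-coefficients of $f$ on $J_j=[u,v]$, for $j\in\{2i-1,2i\}$, is $[\,f(u),\ f(u)+\frac12\theta_ih_if'(u),\ f(v)-\frac12\theta_ih_if'(v),\ f(v)\,]$. Let $\bar\omega_{2i-1}=\frac12$ for $1\le i\le n$ and $\bar\omega_{2i}=\omega_i$ for $1\le i\le n-1$. The $\bar B_l$ are defined by their B-coefficients on the $J_j$ (all B-coefficients on subintervals $J_j$ not mentioned are zero). For $1\le j\le 2n-1$: $\bar B_{2j}$ has lists $[0,0,1,\bar\omega_j]$ on $J_j$ and $[\bar\omega_j,0,0,0]$ on $J_{j+1}$; $\bar B_{2j+1}$ has lists $[0,0,0,1-\bar\omega_j]$ on $J_j$ and $[1-\bar\omega_j,1,0,0]$ on $J_{j+1}$. At the ends: $\bar B_0$ has list $[1,0,0,0]$ on $J_1$; $\bar B_1$ has list $[0,1,0,0]$ on $J_1$; $\bar B_{4n}$ has list $[0,0,1,0]$ on $J_{2n}$; $\bar B_{4n+1}$ has list $[0,0,0,1]$ on $J_{2n}$. *)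

(* Defs.v *)
From mathcomp Require Import all_boot all_order all_algebra.
From mathcomp Require Import all_classical all_reals all_analysis.

Set Implicit Arguments.
Unset Strict Implicit.
Unset Printing Implicit Defensive.

Import Order.TTheory GRing.Theory Num.Theory.
Import numFieldNormedType.Exports.

Local Open Scope classical_set_scope.
Local Open Scope ring_scope.

Section GeneralizedQuadraticSplines.
Context {R : realType}.
Implicit Types (a b u v : R) (f : R -> R).

(* A function on a compact interval is represented by a function on R whose
   values outside the interval are irrelevant. The derivative is therefore taken
   along the interval only: two-sided at interior points, one-sided at the
   endpoints. *)

Definition diff_quot f (t y : R) : R := (f y - f t) / (y - t).

Definition derivable_on u v f (t : R) : Prop :=
  cvg (diff_quot f t y @[y --> within `[u, v] t^']).

Definition derive_on u v f (t : R) : R :=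
  lim (diff_quot f t y @[y --> within `[u, v] t^']).

Definition C1_on u v f : Prop :=
  (forall t, t \in `[u, v] -> derivable_on u v f t) /\
  {within `[u, v], continuous (derive_on u v f)}.

Inductive dyadic_sub u v : R -> R -> Prop :=
| dyadic_self : dyadic_sub u v u v
| dyadic_left p q : dyadic_sub u v p q -> dyadic_sub u v p ((p + q) / 2)
| dyadic_right p q : dyadic_sub u v p q -> dyadic_sub u v ((p + q) / 2) q.

Definition theta (beta : R) : R := 2^-1 * (beta / (beta - 1)).

(* The space V(beta) on [u, v]. *)
Definition merrien u v (beta : R) f : Prop :=
  C1_on u v f /\
  forall p q, dyadic_sub u v p q ->
    let f' := derive_on u v f in
    let th := theta beta in
    let m := (p + q) / 2 in
    let h := q - p in
    f m = 2^-1 * (f p + f q - th * h * (f' q - f' p)) /\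
    f' m = (1 - 2 * th)^-1 *
             ((f q - f p) / h - 2 * th * ((f' p + f' q) / 2)).

Definition bcoefs u v (beta : R) f : seq R :=
  let f' := derive_on u v f in
  let d := theta beta * (v - u) in
  [:: f u; f u + d * f' u; f v - d * f' v; f v].

(* Knots are x 0, ..., x n, and the i-th subinterval, 1 <= i <= n, is
   [x i.-1, x i] with parameter beta i; other values of x and beta are unused. *)

Definition is_partition a b (n : nat) (x : nat -> R) : Prop :=
  [/\ x 0%N = a, x n = b & forall i, (i < n)%N -> x i < x i.+1].

(* GS_2(I, X, beta) with I = [x 0, x n]. *)
Definition GS2 (n : nat) (x beta : nat -> R) f : Prop :=
  C1_on (x 0%N) (x n) f /\
  forall i, (1 <= i <= n)%N -> merrien (x i.-1) (x i) (beta i) f.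

Definition omega (n : nat) (x beta : nat -> R) (i : nat) : R :=
  let th_h j := theta (beta j) * (x j - x j.-1) in
  if i == 0%N then 1
  else if i == n then 0
  else th_h i.+1 / (th_h i + th_h i.+1).

(* B-coefficients of the k-th B-spline on the i-th subinterval, w standing for
   omega. The four end splines k = 0, 1, 2n, 2n+1 are covered by the same
   formula, because w 0 = 1 and w n = 0. *)
Definition bspline_coefs (w : nat -> R) (k i : nat) : seq R :=
  let j := k./2 in
  if i == j then
    (if odd k then [:: 0; 0; 0; 1 - w j] else [:: 0; 0; 1; w j])
  else if i == j.+1 then
    (if odd k then [:: 1 - w j; 1; 0; 0] else [:: w j; 0; 0; 0])
  else [:: 0; 0; 0; 0].

(* f is the k-th generalized quadratic B-spline: on each subinterval it is the
   element of V(beta i) with the prescribed B-coefficients. That the pieces join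
   in a C^1 way is a consequence of the choice of omega, not a requirement. *)
Definition is_bspline (n : nat) (x beta : nat -> R) (k : nat) f : Prop :=
  forall i, (1 <= i <= n)%N ->
    merrien (x i.-1) (x i) (beta i) f /\
    bcoefs (x i.-1) (x i) (beta i) f = bspline_coefs (omega n x beta) k i.

(* Refined data on 2n subintervals: the knot of index 2i is x i, the knot of
   index 2i-1 is the midpoint m_i, and the subintervals 2i-1 and 2i both inherit
   the parameter beta i. *)

Definition refine_knots (x : nat -> R) (j : nat) : R :=
  if odd j then (x j./2 + x j./2.+1) / 2 else x j./2.

Definition refine_params (beta : nat -> R) (j : nat) : R := beta (uphalf j).

End GeneralizedQuadraticSplines.

(* Main.v *)
Require Import Defs.
From mathcomp Require Import all_boot all_order all_algebra.
From mathcomp Require Import all_classical all_reals all_analysis.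
From mathcomp Require Import ring lra zify.

Import Order.TTheory GRing.Theory Num.Theory.
Import numFieldNormedType.Exports.

Local Open Scope classical_set_scope.
Local Open Scope ring_scope.

(** On a subinterval [x i, x i.+1] only the four B-splines of index 2i, ...,
    2i+3 are nonzero, so the B-coefficients [b0, b1, b2, b3] of
    S = \sum_k c k B_k there are read off directly: the two inner ones are
    b1 = c (2i+1) and b2 = c (2i+2) themselves, and the two outer ones are the
    affine combinations, with weights w i and w i.+1, of the pairs
    c (2i), c (2i+1) and c (2i+2), c (2i+3) ([bspline_expansion_bcoefs]).

    The Merrien relations at the midpoint m of the subinterval read
    S m = (b1 + b2) / 2 and S' m = (1 - beta) (b2 - b1) / h, because
    (1 - 2 theta)^-1 = 1 - beta. Hence the B-coefficients of S on the two halves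
    are obtained from [b0, b1, b2, b3] by a corner-cutting rule whose two
    coefficients next to m involve beta and whose other ones are b0, b3 and
    averages of neighbours ([merrien_bisect_bcoefs]).

    The two halves are subintervals of the refined partition, and S also has an
    expansion in the fine basis. Each delta l with 0 < l < 4n+1 is therefore an
    inner B-coefficient of S on exactly one fine subinterval, where corner
    cutting expresses it through the gamma k. The two remaining numbers delta 0 and delta (4n+1) are the values
    of S at the endpoints of the interval, since the end weights are 1 and 0 in
    both bases.

    What analysis there is concerns the derivative along an interval: it is
    linear, and it does not change when the interval is shrunk, so that the
    derivatives occurring in coarse and in fine B-coefficients agree. *)

(** * Derivative along a compact interval *)

(** Limits along this filter are unique because every point of a nondegenerate
    interval, endpoints included, is an accumulation point of it: approach it
    from the right, or from the left if it is the right endpoint. *)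
Lemma within_itv_dnbhs_proper (R : realType) (u v t : R) :
  u < v -> t \in `[u, v] -> ProperFilter (within `[u, v] t^').
Proof.
move=> uv /[!in_itv]/= /andP[ut tv].
apply: Build_ProperFilter => E0.
have {}E0 : \forall y \near t, y != t -> u <= y <= v -> False.
  apply: (@filterS _ (nbhs t) _ _ _ _ E0) => y Ey yt yuv.
  by apply: Ey; rewrite //= in_itv.
have [tv'|vt] := ltP t v.
  near t^'+ => y.
  have ty : t < y by near: y; apply: nbhs_right_gt.
  have yv : y <= v by near: y; apply: nbhs_right_le.
  have : y != t -> u <= y <= v -> False by near: y; apply: cvg_within E0.
  by rewrite gt_eqF// yv (le_trans ut (ltW ty)); apply.
have ut' : u < t by apply: lt_le_trans uv vt.
near t^'- => y.
have yt : y < t by near: y; apply: nbhs_left_lt.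
have uy : u <= y by near: y; apply: nbhs_left_ge.
have : y != t -> u <= y <= v -> False by near: y; apply: cvg_within E0.
by rewrite lt_eqF// uy (le_trans (ltW yt) tv); apply.
Unshelve. all: by end_near.
Qed.

Lemma derive_on_cvg (R : realType) (u v : R) (f : R -> R) (t l : R) :
  u < v -> t \in `[u, v] ->
  diff_quot f t y @[y --> within `[u, v] t^'] --> l -> derive_on u v f t = l.
Proof.
move=> uv tuv fl; have P := within_itv_dnbhs_proper _ _ _ _ uv tuv.
exact: cvg_lim fl.
Qed.

(** The punctured neighbourhood filter within the smaller interval is finer, so
    the limit that exists along the larger one is also the limit along it. *)
Lemma derive_on_sub (R : realType) (u v p q : R) (f : R -> R) (t : R) :
  u <= p -> p < q -> q <= v -> t \in `[p, q] ->
  derivable_on u v f t -> derive_on p q f t = derive_on u v f t.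
Proof.
move=> up pq qv tpq ft; apply: derive_on_cvg => //.
apply: cvg_trans ft; apply: cvg_app; apply: within_subset.
by move=> y /=; rewrite !in_itv/= => /andP[py yq]; apply/andP; split; lra.
Qed.

Lemma cvg_sum_nat (R : realType) (T : Type) (F : set_system T) (N : nat)
    (f : nat -> T -> R) (l : nat -> R) :
  Filter F -> (forall k, (k < N)%N -> f k y @[y --> F] --> l k) ->
  \sum_(0 <= k < N) f k y @[y --> F] --> \sum_(0 <= k < N) l k.
Proof.
move=> FF; elim: N => [|N IH] fl.
  rewrite big_nil [X in X @ _](_ : _ = cst 0); first exact: cvg_cst.
  by apply/funext => y; rewrite big_nil.
rewrite big_nat_recr//=.
rewrite [X in X @ _](_ : _ = (fun y => \sum_(0 <= k < N) f k y) + f N).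
  by apply: cvgD; [apply: IH => k kN; apply: fl; apply: leqW|apply: fl].
by apply/funext => y; rewrite big_nat_recr.
Qed.

Lemma derive_on_sum (R : realType) (u v : R) (N : nat) (c : nat -> R)
    (B : nat -> R -> R) (S : R -> R) (t : R) :
  u < v -> t \in `[u, v] ->
  (forall s, s \in `[u, v] -> S s = \sum_(0 <= k < N) c k * B k s) ->
  (forall k, (k < N)%N -> derivable_on u v (B k) t) ->
  derive_on u v S t = \sum_(0 <= k < N) c k * derive_on u v (B k) t.
Proof.
move=> uv tuv SE dB; apply: derive_on_cvg => //.
have quotE : {near within `[u, v] t^',
    (fun y => \sum_(0 <= k < N) c k * diff_quot (B k) t y) =1 diff_quot S t}.
  rewrite near_withinE; near=> y => yuv.
  rewrite /diff_quot !SE // -sumrB mulr_suml.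
  by apply: eq_bigr => k _; rewrite mulrA mulrBr.
apply: cvg_trans; first exact: near_eq_cvg quotE.
by apply: cvg_sum_nat => k kN; apply: cvgM; [apply: cvg_cst|apply: dB].
Unshelve. all: by end_near.
Qed.

(** * B-coefficients of a B-spline expansion *)

Lemma bcoefs_sum (R : realType) (u v be : R) (N : nat) (c : nat -> R)
    (B : nat -> R -> R) (S : R -> R) (r : nat) :
  u < v ->
  (forall k, (k < N)%N -> merrien u v be (B k)) ->
  (forall t, t \in `[u, v] -> S t = \sum_(0 <= k < N) c k * B k t) ->
  (bcoefs u v be S)`_r = \sum_(0 <= k < N) c k * (bcoefs u v be (B k))`_r.
Proof.
move=> uv BV SE.
have uI : u \in `[u, v] by rewrite in_itv/= lexx ltW.
have vI : v \in `[u, v] by rewrite in_itv/= lexx ltW.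
have dS t : t \in `[u, v] ->
    derive_on u v S t = \sum_(0 <= k < N) c k * derive_on u v (B k) t.
  by move=> tI; apply: derive_on_sum => // k kN; apply: (BV k kN).1.1.
rewrite /bcoefs !SE // !dS // !mulr_sumr -sumrB -big_split.
case: r => [|[|[|[|r]]]] //=; last first.
  by rewrite ?nth_nil big1// => k _; rewrite ?nth_nil mulr0.
all: by apply: eq_bigr => k _; ring.
Qed.

(** Only the indices 2i, ..., 2i+3 contribute. The identity holds for every rank
    r, out-of-range entries being 0, which makes it match [bcoefs_sum]. *)
Lemma sum_bspline_coefs (R : realType) (w c : nat -> R) (n i r : nat) :
  (i < n)%N ->
  \sum_(0 <= k < 2 * n + 2) c k * (bspline_coefs w k i.+1)`_r =
  [:: w i * c (2 * i)%N + (1 - w i) * c (2 * i).+1; c (2 * i).+1;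
      c (2 * i).+2;
      w i.+1 * c (2 * i).+2 + (1 - w i.+1) * c (2 * i).+3]`_r.
Proof.
move=> i_lt.
have off k : (k < 2 * i)%N || (2 * i + 4 <= k)%N ->
    c k * (bspline_coefs w k i.+1)`_r = 0.
  move=> k_off; rewrite /bspline_coefs !ifF; try by apply/eqP; lia.
  by case: r => [|[|[|[|r]]]] /=; rewrite ?nth_nil mulr0.
rewrite (@big_cat_nat _ _ _ (2 * i)%N)//=; last by lia.
rewrite (@big_cat_nat _ _ _ (2 * i + 4)%N _ (2 * n + 2))//=; try by lia.
rewrite [X in X + _]big_nat_cond [X in _ + (_ + X)]big_nat_cond.
rewrite [X in X + _]big1 ?add0r; last by move=> k kP; apply: off; lia.
rewrite [X in _ + X]big1 ?addr0; last by move=> k kP; apply: off; lia.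
rewrite !addnS addn0 4?big_ltn ?big_geq ?addr0; try by lia.
rewrite /bspline_coefs.
have -> : (2 * i)./2 = i by lia.
have -> : (2 * i).+1./2 = i by lia.
have -> : (2 * i).+2./2 = i.+1 by lia.
have -> : (2 * i).+3./2 = i.+1 by lia.
rewrite !eqxx /= oddM /= (gtn_eqF (ltnSn i)).
case: r {off} => [|[|[|[|r]]]] /=; rewrite ?nth_nil; ring.
Qed.

(** This inverts the expansion: the coefficients c (2i+1) and c (2i+2) are the
    inner B-coefficients of S on the subinterval, so as i varies every c k
    except the first and the last occurs as one entry of such a list. *)
Lemma bspline_expansion_bcoefs (R : realType) (n : nat) (x beta : nat -> R)
    (B : nat -> R -> R) (S : R -> R) (c : nat -> R) (i : nat) :
  let w := omega n x beta in
  (i < n)%N -> x i < x i.+1 ->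
  (forall k, (k <= 2 * n + 1)%N -> is_bspline n x beta k (B k)) ->
  (forall t, t \in `[x i, x i.+1] ->
     S t = \sum_(0 <= k < 2 * n + 2) c k * B k t) ->
  bcoefs (x i) (x i.+1) (beta i.+1) S =
  [:: w i * c (2 * i)%N + (1 - w i) * c (2 * i).+1; c (2 * i).+1;
      c (2 * i).+2;
      w i.+1 * c (2 * i).+2 + (1 - w i.+1) * c (2 * i).+3].
Proof.
move=> w i_lt x_lt Bk SE.
apply: (@eq_from_nth _ 0) => // r _.
have BP k : (k < 2 * n + 2)%N ->
    merrien (x i) (x i.+1) (beta i.+1) (B k) /\
    bcoefs (x i) (x i.+1) (beta i.+1) (B k) = bspline_coefs w k i.+1.
  by move=> k_lt; apply: (Bk k _ i.+1); lia.
rewrite (bcoefs_sum _ _ _ _ _ _ _ _ _ x_lt _ SE); last by move=> k /BP[].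
rewrite -(@sum_bspline_coefs _ w c n)//.
by apply: eq_big_nat => k /andP[_ /BP[_ ->]].
Qed.

(** * Corner cutting at the midpoint *)

(** The offset theta h is halved with h, hence the averages (b0 + b1) / 2 and
    (b2 + b3) / 2 next to the old endpoints. Next to m the offset is applied to
    f' m, giving (b1 + b2) / 2 -+ theta / (2 (1 - 2 theta)) (b2 - b1), and
    -2 theta / (1 - 2 theta) = beta. *)
Lemma merrien_bisect_bcoefs (R : realType) (u v be : R) (f : R -> R)
    (b0 b1 b2 b3 : R) :
  let m := (u + v) / 2 in
  u < v -> be < 0 -> merrien u v be f ->
  bcoefs u v be f = [:: b0; b1; b2; b3] ->
  bcoefs u m be f =
    [:: b0; (b0 + b1) / 2;
        (1 / 2 - 1 / 4 * be) * b1 + (1 / 2 + 1 / 4 * be) * b2;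
        (b1 + b2) / 2] /\
  bcoefs m v be f =
    [:: (b1 + b2) / 2;
        (1 / 2 + 1 / 4 * be) * b1 + (1 / 2 - 1 / 4 * be) * b2;
        (b2 + b3) / 2; b3].
Proof.
move=> m uv be0 [[df _] fV] [<- <- <- <-].
have um : u < m by rewrite /m; lra.
have mv : m < v by rewrite /m; lra.
have [fm dfm] := fV _ _ (dyadic_self u v).
have sub p q t : u <= p -> p < q -> q <= v -> p <= t <= q ->
    derive_on p q f t = derive_on u v f t.
  move=> up pq qv ptq; apply: derive_on_sub => //.
  by apply: df; move/andP: ptq => [pt tq]; rewrite in_itv/=; apply/andP; split; lra.
rewrite /bcoefs !sub ?lexx ?ltW//.
move: fm dfm; rewrite -/m => -> ->.
rewrite /theta /m.
have be1 : be - 1 != 0 by rewrite lt_eqF//; lra.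
have vu : v - u != 0 by rewrite gt_eqF//; lra.
have one_m2th : 1 - 2 * (2^-1 * (be / (be - 1))) = (1 - be)^-1.
  by field; rewrite be1 gt_eqF//; lra.
rewrite one_m2th invrK.
split; congr [:: _; _; _; _]; field; rewrite ?be1 ?vu//.
Qed.

(** * Refinement relations *)

Lemma partition_le (R : realType) (a b : R) (n : nat) (x : nat -> R) (i j : nat) :
  is_partition a b n x -> (i <= j <= n)%N -> x i <= x j.
Proof.
move=> [_ _ x_lt] /andP[].
elim: j => [|j IH]; first by rewrite leqn0 => /eqP ->.
rewrite leq_eqVlt => /orP[/eqP -> //|ij jn].
by apply: le_trans (IH _ _) (ltW (x_lt _ jn)); lia.
Qed.

(** The B-coefficients of S on the two halves of [x i, x i.+1] are computed twice,
    by corner cutting from the coarse expansion and directly from the fine one,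
    and the lists are compared. The inner entries give d (4i+1), ..., d (4i+4);
    the outer entries are of use at the ends of the whole interval, where the
    weights are 1 and 0. *)
Lemma refinement_on_subinterval (R : realType) (n : nat) (a b : R) (x beta : nat -> R)
    (B Bbar : nat -> R -> R) (S : R -> R) (g d : nat -> R) (i : nat)
    (w := omega n x beta)
    (wbar := omega (2 * n) (refine_knots x) (refine_params beta)) :
  is_partition a b n x ->
  (forall i, (1 <= i <= n)%N -> -1 <= beta i < 0) ->
  (forall k, (k <= 2 * n + 1)%N -> is_bspline n x beta k (B k)) ->
  (forall l, (l <= 4 * n + 1)%N ->
     is_bspline (2 * n) (refine_knots x) (refine_params beta) l (Bbar l)) ->
  GS2 n x beta S ->
  (forall t, t \in `[a, b] -> S t = \sum_(0 <= k < 2 * n + 2) g k * B k t) ->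
  (forall t, t \in `[a, b] ->
     S t = \sum_(0 <= l < 4 * n + 2) d l * Bbar l t) ->
  (i < n)%N ->
  let b0 := w i * g (2 * i)%N + (1 - w i) * g (2 * i).+1 in
  let b1 := g (2 * i).+1 in
  let b2 := g (2 * i).+2 in
  let b3 := w i.+1 * g (2 * i).+2 + (1 - w i.+1) * g (2 * i).+3 in
  [/\ wbar (2 * i)%N * d (4 * i)%N + (1 - wbar (2 * i)%N) * d (4 * i).+1 = b0,
      d (4 * i).+1 = (b0 + b1) / 2 &
      d (4 * i).+2 =
        (1 / 2 - 1 / 4 * beta i.+1) * b1 + (1 / 2 + 1 / 4 * beta i.+1) * b2] /\
  [/\ d (4 * i).+3 =
        (1 / 2 + 1 / 4 * beta i.+1) * b1 + (1 / 2 - 1 / 4 * beta i.+1) * b2,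
      d (4 * i).+4 = (b2 + b3) / 2 &
      wbar (2 * i).+2 * d (4 * i).+4 +
        (1 - wbar (2 * i).+2) * d (4 * i.+1).+1 = b3].
Proof.
move=> x_part beta_range B_spline Bbar_spline [_ SV] S_coarse S_fine i_lt.
move=> b0 b1 b2 b3.
have [x0 xn x_lt] := x_part.
have xi := x_lt i i_lt.
set m := (x i + x i.+1) / 2.
have [xm mx] : x i < m /\ m < x i.+1 by rewrite /m; split; lra.
have sub p q t : x i <= p -> q <= x i.+1 -> t \in `[p, q] -> t \in `[a, b].
  move=> xp qx; rewrite !in_itv/= => /andP[pt tq].
  have := partition_le _ _ _ _ _ 0 i x_part.
  have := partition_le _ _ _ _ _ i.+1 n x_part.
  rewrite x0 xn leq0n leqnn i_lt ltnW// => /(_ isT) ? /(_ isT) ?.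
  by apply/andP; split; lra.
have be0 : beta i.+1 < 0 by have /andP[] := beta_range i.+1 i_lt.
have coarse : bcoefs (x i) (x i.+1) (beta i.+1) S = [:: b0; b1; b2; b3].
  apply: (@bspline_expansion_bcoefs _ n _ _ B) => // t tI.
  by apply: S_coarse; apply: sub tI.
have [left_half right_half] :=
  merrien_bisect_bcoefs _ _ _ _ _ _ _ _ _ xi be0 (SV i.+1 i_lt) coarse.
have k0 : refine_knots x (2 * i) = x i.
  by rewrite /refine_knots oddM/=; congr x; lia.
have k1 : refine_knots x (2 * i).+1 = m.
  by rewrite /refine_knots /= oddM/= /m; congr ((x _ + x _) / 2); lia.
have k2 : refine_knots x (2 * i).+2 = x i.+1.
  by rewrite /refine_knots /= oddM/=; congr x; lia.
have p1 : refine_params beta (2 * i).+1 = beta i.+1.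
  by rewrite /refine_params; congr beta; lia.
have p2 : refine_params beta (2 * i).+2 = beta i.+1.
  by rewrite /refine_params; congr beta; lia.
have Bbar' l : (l <= 2 * (2 * n) + 1)%N ->
    is_bspline (2 * n) (refine_knots x) (refine_params beta) l (Bbar l).
  by move=> l_le; apply: Bbar_spline; lia.
have S_fine' p q : x i <= p -> q <= x i.+1 -> forall t, t \in `[p, q] ->
    S t = \sum_(0 <= l < 2 * (2 * n) + 2) d l * Bbar l t.
  by move=> xp qx t tI; rewrite mulnA; apply: S_fine; apply: sub tI.
have l_lt : (2 * i < 2 * n)%N by lia.
have r_lt : ((2 * i).+1 < 2 * n)%N by lia.
have := @bspline_expansion_bcoefs _ (2 * n) _ _ _ S d (2 * i) l_lt _ Bbar' _.
have := @bspline_expansion_bcoefs _ (2 * n) _ _ _ S d (2 * i).+1 r_lt _ Bbar' _.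
rewrite k0 k1 k2 p1 p2 left_half right_half.
have -> : (2 * (2 * i).+1 = (4 * i).+2)%N by lia.
have -> : (2 * (2 * i) = 4 * i)%N by lia.
have -> : (4 * i).+2.+3 = (4 * i.+1).+1 by lia.
move=> /(_ mx (S_fine' _ _ (ltW xm) (lexx _))) [_ r1 r2 r3].
by move=> /(_ xm (S_fine' _ _ (lexx _) (ltW mx))) [l0 l1 l2 _]; do 2!split.
Qed.

Theorem theorem7 (R : realType) (n : nat) (a b : R) (x beta : nat -> R)
    (B Bbar : nat -> R -> R) (S : R -> R) (gamma delta : nat -> R)
    (n_ge1 : (1 <= n)%N)
    (x_part : is_partition a b n x)
    (beta_range : forall i, (1 <= i <= n)%N -> -1 <= beta i < 0)
    (B_spline : forall k, (k <= 2 * n + 1)%N -> is_bspline n x beta k (B k))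
    (Bbar_spline : forall l, (l <= 4 * n + 1)%N ->
       is_bspline (2 * n) (refine_knots x) (refine_params beta) l (Bbar l))
    (S_GS2 : GS2 n x beta S)
    (S_coarse : forall t, t \in `[a, b] ->
       S t = \sum_(0 <= k < 2 * n + 2) gamma k * B k t)
    (S_fine : forall t, t \in `[a, b] ->
       S t = \sum_(0 <= l < 4 * n + 2) delta l * Bbar l t) :
  (forall i, (1 <= i <= n)%N ->
     delta (4 * i - 2)%N =
       (1 / 2 - 1 / 4 * beta i) * gamma (2 * i - 1)%N +
       (1 / 2 + 1 / 4 * beta i) * gamma (2 * i)%N /\
     delta (4 * i - 1)%N =
       (1 / 2 + 1 / 4 * beta i) * gamma (2 * i - 1)%N +
       (1 / 2 - 1 / 4 * beta i) * gamma (2 * i)%N) /\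
  (forall i, (i <= n)%N ->
     let w := omega n x beta i in
     delta (4 * i)%N =
       1 / 2 * (1 + w) * gamma (2 * i)%N +
       1 / 2 * (1 - w) * gamma (2 * i + 1)%N /\
     delta (4 * i + 1)%N =
       1 / 2 * w * gamma (2 * i)%N +
       1 / 2 * (2 - w) * gamma (2 * i + 1)%N).
Proof.
have local i (i_lt : (i < n)%N) := refinement_on_subinterval _ _ _ _ _ _ _ _ _ _ _ _
  x_part beta_range B_spline Bbar_spline S_GS2 S_coarse S_fine i_lt.
split=> [[//|i] /andP[_ i_lt] | i i_le w].
  have [[_ _ d2] [d3 _ _]] := local i i_lt.
  have -> : (4 * i.+1 - 2 = (4 * i).+2)%N by lia.
  have -> : (4 * i.+1 - 1 = (4 * i).+3)%N by lia.
  have -> : (2 * i.+1 - 1 = (2 * i).+1)%N by lia.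
  have -> : (2 * i.+1 = (2 * i).+2)%N by lia.
  by split.
split.
  (* For i > 0, delta (4i) is the third B-coefficient on the right half of the
     subinterval that ends at x i; delta 0 has no such subinterval. *)
  case: i i_le @w => [|i] i_lt w.
    have [[d0 _ _] _] := local 0%N n_ge1.
    by move: d0; rewrite /w /omega /= => d0; lra.
  have [_ [_ d4 _]] := local i i_lt.
  have -> : (4 * i.+1 = (4 * i).+4)%N by lia.
  have -> : (2 * i.+1 = (2 * i).+2)%N by lia.
  by rewrite d4 addn1 -/w; lra.
(* For i < n, delta (4i+1) is the second B-coefficient on the left half of the
   subinterval that starts at x i; delta (4n+1) has no such subinterval. *)
have [i_lt|n_le] := ltnP i n.
  have [[_ d1 _] _] := local i i_lt.
  by rewrite !addn1 d1 -/w; lra.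
have {i_le n_le} in_ : i = n by lia.
have n1_lt : (n.-1 < n)%N by lia.
have [_ [_ _ d5]] := local n.-1 n1_lt.
move: d5; rewrite /w in_ prednK //.
have -> : (2 * n.-1).+3 = (2 * n).+1 by lia.
have -> : (2 * n.-1).+2 = (2 * n)%N by lia.
rewrite /omega !eqxx !gtn_eqF ?muln_gt0 //=.
by rewrite !addn1 => d5; lra.
Qed.
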